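(* Let $(X,d)$ be a complete $b$-rectangular metric space with parameter $s\ge 1$, let $T:X\to X$ be a mapping, and let $\varphi:X\to\mathbb{R}^+$ be a lower semicontinuous function. Suppose that $T$ is a convex $C$-class-$F$-generalized weakly contractive mapping, i.e. there are $a,b,c\in[0,\infty)$ with $a+b+c>0$ and $\psi\in\Phi$, $\phi\in\Phi_u$, $F\in\mathcal{C}$ such that the triple $(\psi,\phi,F)$ is not monotone and for all $x,y\in X$ $$\psi\bigl(s^{2}d(Tx,Ty)+\varphi(Tx)+\varphi(Ty)\bigr)\le F\bigl(\psi(M(x,y,d,T,\varphi)),\,\phi(M(x,y,d,T,\varphi))\bigr),$$ where $$M(x,y,d,T,\varphi)=\frac{a[d(x,y)+\varphi(x)+\varphi(y)]+b[d(x,Tx)+\varphi(x)+\varphi(Tx)]+c[d(y,Ty)+\varphi(y)+\varphi(Ty)]}{a+b+c}.$$ Then $T$ has a unique fixed point $z\in X$ (so $z=Tz$), and $\varphi(z)=0$.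
   Context: $\mathbb{R}^+=[0,+\infty)$. A $b$-rectangular metric space with parameter (coefficient) $s\ge1$ is a nonempty set $X$ with a function $d:X\times X\to[0,+\infty)$ such that for all $x,y\in X$: (1) $d(x,y)=0$ iff $x=y$; (2) $d(x,y)=d(y,x)$; (3) $d(x,y)\le s[d(x,u)+d(u,v)+d(v,y)]$ for all distinct points $u,v\in X\setminus\{x,y\}$. A sequence $(x_n)$ converges to $x$ if $d(x_n,x)\to0$; it is Cauchy if $d(x_n,x_m)\to0$ as $n,m\to\infty$; $X$ is complete if every Cauchy sequence converges to some point of $X$. A function $\varphi:X\to\mathbb{R}^+$ is lower semicontinuous if for all $x\in X$ and all sequences $x_n\to x$ in $X$, $\varphi(x)\le\liminf_{n\to\infty}\varphi(x_n)$. $\Phi$ is the set of altering distance functions: functions $\psi:[0,\infty)\to[0,\infty)$ that are continuous, nondecreasing, and satisfy $\psi(t)=0$ iff $t=0$. $\Phi_u$ is the set of continuous functions $\phi:[0,\infty)\to[0,\infty)$ with $\phi(t)>0$ for all $t>0$ (and $\phi(0)\ge0$). $\mathcal{C}$ is the set of $C$-class functions: continuous $F:[0,\infty)^2\to\mathbb{R}$ such that for all $p,q\in[0,\infty)$, $F(p,q)\le p$, and $F(p,q)=p$ implies $p=0$ or $q=0$. A triple $(\psi,\phi,F)$ with $\psi\in\Phi$, $\phi\in\Phi_u$, $F\in\mathcal{C}$ is called monotone if for all $p,q\in[0,\infty)$, $p\le q$ implies $F(\psi(p),\phi(p))\le F(\psi(q),\phi(q))$; it is not monotone if this implication fails for some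 $p,q\in[0,\infty)$. *)

(* Defs.v *)
From mathcomp Require Import all_boot all_order all_algebra.
From mathcomp Require Import all_classical all_reals all_analysis.

Set Implicit Arguments.
Unset Strict Implicit.
Unset Printing Implicit Defensive.

Import Order.TTheory GRing.Theory Num.Theory.
Import numFieldNormedType.Exports.

Local Open Scope classical_set_scope.
Local Open Scope ring_scope.

(* Functions on [0, +oo[ (resp. [0, +oo[ ^ 2) are total functions on R (resp.
   R * R), of which only the restriction to that domain is ever constrained;
   in particular continuity is relative to the domain (subspace topology). *)

Section BRectangular.
Context {R : realType} {X : Type}.
Implicit Types (s : R) (d : X -> X -> R) (vphi : X -> R).

Record brectangular_metric s d : Prop := BRectangularMetric {
  brm_inhabited : inhabited X ;
  brm_coef_ge1 : 1 <= s ;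
  brm_ge0 : forall x y : X, 0 <= d x y ;
  brm_eq0 : forall x y : X, d x y = 0 <-> x = y ;
  brm_sym : forall x y : X, d x y = d y x ;
  brm_rect : forall x y u v : X,
    u <> v -> u <> x -> u <> y -> v <> x -> v <> y ->
    d x y <= s * (d x u + d u v + d v y)
}.

Definition dcvg d (u : nat -> X) (x : X) : Prop :=
  d (u n) x @[n --> \oo] --> (0 : R).

Definition dcauchy d (u : nat -> X) : Prop :=
  d (u nm.1) (u nm.2) @[nm --> (\oo, \oo)] --> (0 : R).

Definition dcomplete d : Prop :=
  forall u : nat -> X, dcauchy d u -> exists x, dcvg d u x.

(* The inferior limit is taken in \bar R since it may be +oo. *)
Definition seq_lower_semicontinuous d vphi : Prop :=
  forall (x : X) (u : nat -> X), dcvg d u x ->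
    ((vphi x)%:E <= limn_einf (fun n => (vphi (u n))%:E))%E.

End BRectangular.

Section ControlFunctions.
Context {R : realType}.
Implicit Types (psi phi : R -> R) (F : R * R -> R).

Record altering_distance psi : Prop := AlteringDistance {
  altd_ge0 : forall t : R, 0 <= t -> 0 <= psi t ;
  altd_continuous : {within `[0, +oo[, continuous psi} ;
  altd_nondecreasing : forall t1 t2 : R,
    0 <= t1 -> t1 <= t2 -> psi t1 <= psi t2 ;
  altd_eq0 : forall t : R, 0 <= t -> psi t = 0 <-> t = 0
}.

Record ultra_altering_distance phi : Prop := UltraAlteringDistance {
  ualtd_ge0 : forall t : R, 0 <= t -> 0 <= phi t ;
  ualtd_continuous : {within `[0, +oo[, continuous phi} ;
  ualtd_gt0 : forall t : R, 0 < t -> 0 < phi t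
}.

Record C_class F : Prop := CClass {
  C_class_continuous : {within `[0, +oo[ `*` `[0, +oo[, continuous F} ;
  C_class_le : forall p q : R, 0 <= p -> 0 <= q -> F (p, q) <= p ;
  C_class_eq : forall p q : R, 0 <= p -> 0 <= q ->
    F (p, q) = p -> p = 0 \/ q = 0
}.

Definition monotone_triple psi phi F : Prop :=
  forall p q : R, 0 <= p -> 0 <= q ->
    p <= q -> F (psi p, phi p) <= F (psi q, phi q).

End ControlFunctions.

Section Contraction.
Context {R : realType} {X : Type}.
Implicit Types (s a b c : R) (d : X -> X -> R) (T : X -> X) (vphi : X -> R).

Definition convex_M a b c d T vphi (x y : X) : R :=
  (a * (d x y + vphi x + vphi y)
   + b * (d x (T x) + vphi x + vphi (T x))
   + c * (d y (T y) + vphi y + vphi (T y))) / (a + b + c).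

Definition convex_C_class_weakly_contractive s d T vphi : Prop :=
  exists (a b c : R) (psi phi : R -> R) (F : R * R -> R),
    [/\ [/\ 0 <= a, 0 <= b, 0 <= c & 0 < a + b + c],
        [/\ altering_distance psi, ultra_altering_distance phi & C_class F],
        ~ monotone_triple psi phi F &
        forall x y : X,
          psi (s ^+ 2 * d (T x) (T y) + vphi (T x) + vphi (T y))
          <= F (psi (convex_M a b c d T vphi x y),
                phi (convex_M a b c d T vphi x y))].

End Contraction.

(* Main.v *)
Require Import Defs.
From mathcomp Require Import all_boot all_order all_algebra.
From mathcomp Require Import all_classical all_reals all_analysis.
From mathcomp Require Import zify lra.

Import Order.TTheory GRing.Theory Num.Theory.
Import numFieldNormedType.Exports.

Local Open Scope classical_set_scope.
Local Open Scope ring_scope.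

(** Write [w x y := d x y + vphi x + vphi y] for the weighted distance,
    [L x y] for the argument of [psi] on the left-hand side of the contraction
    and [M x y] for the one on the right; [M] is a convex combination of
    [w x y], [w x (T x)], [w y (T y)], and [w (T x) (T y) <= L x y].

    The control functions enter through a single consequence, a Meir-Keeler
    condition: for each [e > 0] there is [h > 0] such that [M x y < e + h]
    implies [L x y < e] ([C_class_meir_keeler]). It holds because
    [F (psi t, phi t) < psi t] for [t > 0], an inequality that persists near
    [t = e] by continuity, while [psi] is nondecreasing.
    It implies [L <= M], strictly where [M > 0]; this gives uniqueness of the
    fixed point and the vanishing of [vphi] there.

    For existence, follow an orbit [x n]. A nonnegative sequence obeying the
    Meir-Keeler condition from each term to the next tends to [0]
    ([meir_keeler_seq_cvg0]), so [w (x n) (x (n + k))] tends to [0] for each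
    fixed [k] ([orbit_gap_cvg0]). Unless the orbit reaches a fixed point, its
    points are distinct, so the rectangular inequality applies to the path
    [n, n + 1, n + k + 1, n + k + 2]: together with Meir-Keeler it carries a
    bound on the gap [k] to the gap [k + 2], and the gaps [0, 1, 2] start the
    induction. This makes the bound uniform in [k] ([orbit_gap_uniform]), hence
    the orbit Cauchy. Lower semicontinuity yields [vphi z = 0] at a limit
    [z]. Finally [L] is symmetric, so that
    [2 * L (x n) z <= M (x n) z + M z (x n)], where [w z (T z)] occurs with
    total coefficient at most [1] on the right, but in the limit is bounded by
    [L (x n) z] on the left; this forces [w z (T z) = 0]
    ([orbit_limit_fixed]). *)

Set Implicit Arguments.
Unset Strict Implicit.

(** * Sequences and continuity *)

Lemma cvg0_ge0P (R : realType) (u : nat -> R) (u_ge0 : forall n, 0 <= u n) :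
  u n @[n --> \oo] --> (0 : R) <->
  forall e, 0 < e -> \forall n \near \oo, u n < e.
Proof.
have norm_sub0 n : `|0 - u n| = u n by rewrite sub0r normrN ger0_norm.
split=> [/cvgrPdist_lt u0 e e0|u0].
  by near=> n; rewrite -norm_sub0; near: n; exact: u0.
apply/cvgrPdist_lt => e e0; near=> n; rewrite norm_sub0; near: n; exact: u0.
Unshelve. all: by end_near. Qed.

Lemma injective_eventually_neq (X : Type) (u : nat -> X) (p : X)
    (u_inj : injective u) : \forall n \near \oo, u n <> p.
Proof.
have [[N uN]|never] := pselect (exists N, u N = p); last first.
  by near=> n => un; apply: never; exists n.
near=> n => un.
have ltNn : (N < n)%N by near: n; exact: nbhs_infty_gt.
by have := u_inj N n (etrans uN (esym un)) => eNn; rewrite eNn ltnn in ltNn.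
Unshelve. all: by end_near. Qed.

(** The condition makes [u] nonincreasing (take [e] to be an offending
    [u n.+1]), and a positive infimum [i] is impossible: some [u n] lies below
    [i + h], so that [u n.+1 < i]. *)
Lemma meir_keeler_seq_cvg0 (R : realType) (u : nat -> R)
    (u_ge0 : forall n, 0 <= u n)
    (u_mk : forall e, 0 < e ->
      exists2 h, 0 < h & forall n, u n < e + h -> u n.+1 < e) :
  u n @[n --> \oo] --> (0 : R).
Proof.
apply/(cvg0_ge0P u_ge0) => e e0.
have u_noninc n : u n.+1 <= u n.
  rewrite leNgt; apply/negP => lt_u.
  have uS_gt0 : 0 < u n.+1 by exact: le_lt_trans lt_u.
  have [h h0 /(_ n)] := u_mk _ uS_gt0.
  by rewrite ltxx => /(_ (lt_trans lt_u _)) contra; apply/notF/contra; lra.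
have lbu : has_lbound (range u) by exists 0 => _ [n _ <-].
have infu : has_inf (range u) by split => //; exists (u 0%N), 0%N.
have inf_le n : inf (range u) <= u n by apply: ge_inf => //; exists n.
have inf0 : inf (range u) <= 0.
  rewrite leNgt; apply/negP => inf_gt0.
  have [h h0 hh] := u_mk _ inf_gt0.
  have [_ [n _ <-] /hh] := inf_adherent h0 infu.
  by rewrite ltNge inf_le.
have [_ [N _ <-] uN] := inf_adherent e0 infu.
near=> n.
have leNn : (N <= n)%N by near: n; exact: nbhs_infty_ge.
apply: (@le_lt_trans _ _ (u N)); last by lra.
by rewrite -(subnKC leNn); elim: (n - N)%N => [|k IH];
  rewrite ?addn0 // addnS (le_trans (u_noninc _)).
Unshelve. all: by end_near. Qed.

Lemma within_continuous_at (S T : topologicalType) (A : set S) (f : S -> T)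
    (x : S) (Ax : A° x) (fA : {within A, continuous f}) :
  {for x, continuous f}.
Proof.
have := (subspace_continuousP A f).1 fA x (interior_subset Ax).
by rewrite (within_interior Ax).
Qed.

(** * The Meir-Keeler condition *)

(** Assume [e <= l]. If [e <= t < e + h], continuity at [e] gives
    [psi l <= F (psi t, phi t) < psi e <= psi l]. If [0 < t < e], then
    [F (psi t, phi t) < psi t <= psi e] already contradicts this, and at [t = 0]
    the bound [F (0, phi 0) <= 0] does. *)
Lemma C_class_meir_keeler (R : realType) (psi phi : R -> R) (F : R * R -> R)
    (hpsi : altering_distance psi) (hphi : ultra_altering_distance phi)
    (hF : C_class F) (e : R) (e0 : 0 < e) :
  exists2 h, 0 < h & forall l t, 0 <= t -> t < e + h ->
    psi l <= F (psi t, phi t) -> l < e.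
Proof.
have psi_gt0 t : 0 < t -> 0 < psi t.
  move=> t0; rewrite lt_neqAle (altd_ge0 hpsi) ?(ltW t0)// andbT eq_sym.
  by apply/eqP => /(altd_eq0 hpsi (ltW t0)) te; rewrite te ltxx in t0.
have F_lt t : 0 < t -> F (psi t, phi t) < psi t.
  move=> t0; have pt := psi_gt0 _ t0; have qt := ualtd_gt0 hphi t0.
  rewrite lt_neqAle (C_class_le hF) ?(ltW pt) ?(ltW qt)// andbT.
  apply/eqP => /(C_class_eq hF (ltW pt) (ltW qt)) [z|z].
    by rewrite z ltxx in pt.
  by rewrite z ltxx in qt.
have interior_gt0 (x : R) : 0 < x -> (`[0, +oo[%classic : set R)° x.
  by move=> x0; rewrite interior_itv_bndy /= in_itv /= x0.
have psi_cvg := within_continuous_at (interior_gt0 _ e0) (altd_continuous hpsi).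
have phi_cvg :=
  within_continuous_at (interior_gt0 _ e0) (ualtd_continuous hphi).
have F_cvg : {for (psi e, phi e), continuous F}.
  apply: within_continuous_at (C_class_continuous hF).
  exists (`[0, +oo[%classic, `[0, +oo[%classic); last by [].
  by split; apply: interior_gt0; [exact: psi_gt0|exact: ualtd_gt0].
have G_cvg : F (psi t, phi t) @[t --> e] --> F (psi e, phi e).
  exact: (cvg_comp _ _ (cvg_pair psi_cvg phi_cvg) F_cvg).
have /nbhs_ballP[h /= h0 near_e] :
    \forall t \near e, F (psi t, phi t) < psi e.
  exact: (cvgr_lt _ G_cvg _ (F_lt _ e0)).
exists h => // l t t0 lt_t psi_l.
rewrite ltNge; apply/negP => le_el.
have psi_el := altd_nondecreasing hpsi (ltW e0) le_el.
have [le_et|lt_te] := leP e t.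
  have : F (psi t, phi t) < psi e.
    by apply: near_e; rewrite /ball /= ler0_norm; lra.
  by lra.
move: t0; rewrite le_eqVlt => /orP[/eqP t0|t0].
  have psi0 : psi t = 0 by apply/(altd_eq0 hpsi); rewrite -t0.
  have : F (psi t, phi t) <= 0.
    rewrite -[leRHS]psi0 (C_class_le hF) ?psi0//.
    by apply: (ualtd_ge0 hphi); rewrite -t0.
  by have := psi_gt0 _ e0; lra.
have := F_lt _ t0; have := altd_nondecreasing hpsi (ltW t0) (ltW lt_te); lra.
Qed.

(** * Contractions of Meir-Keeler type *)

Section FixedPoint.
Context {R : realType} {X : Type} {s a b c : R} {d : X -> X -> R}.
Context {T : X -> X} {vphi : X -> R}.
Hypothesis hd : brectangular_metric s d.
Hypothesis vphi_ge0 : forall x, 0 <= vphi x.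
Hypotheses (a_ge0 : 0 <= a) (b_ge0 : 0 <= b) (c_ge0 : 0 <= c).
Hypothesis abc_gt0 : 0 < a + b + c.

Definition weighted_dist (x y : X) : R := d x y + vphi x + vphi y.

Definition contracted_dist (x y : X) : R :=
  s ^+ 2 * d (T x) (T y) + vphi (T x) + vphi (T y).

Local Notation w := weighted_dist.
Local Notation L := contracted_dist.
Local Notation M := (convex_M a b c d T vphi).

Hypothesis meir_keeler : forall e, 0 < e ->
  exists2 h, 0 < h & forall x y, M x y < e + h -> L x y < e.

Let d_ge0 := brm_ge0 hd.
Let s_ge1 := brm_coef_ge1 hd.

Lemma weighted_dist_ge0 x y : 0 <= w x y.
Proof. by rewrite /w !addr_ge0. Qed.

Lemma weighted_dist_sym x y : w x y = w y x.
Proof. by rewrite /w (brm_sym hd) addrAC. Qed.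

Lemma convex_ME x y :
  M x y = (a * w x y + b * w x (T x) + c * w y (T y)) / (a + b + c).
Proof. by []. Qed.

Lemma convex_M_ge0 x y : 0 <= M x y.
Proof.
by rewrite convex_ME divr_ge0 ?(ltW abc_gt0)// !addr_ge0 ?mulr_ge0//;
  exact: weighted_dist_ge0.
Qed.

Lemma convex_M_le B x y :
  w x y <= B -> w x (T x) <= B -> w y (T y) <= B -> M x y <= B.
Proof.
move=> xy xT yT; rewrite convex_ME ler_pdivrMr// [leRHS]mulrC !mulrDl.
by rewrite !lerD// ler_wpM2l.
Qed.

Lemma convex_M_lt B x y :
  w x y < B -> w x (T x) < B -> w y (T y) < B -> M x y < B.
Proof.
move=> xy xT yT.
apply: (@le_lt_trans _ _ (Num.max (w x y) (Num.max (w x (T x)) (w y (T y))))).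
  by apply: convex_M_le; rewrite !le_max lexx ?orbT.
by rewrite !gt_max xy xT yT.
Qed.

Lemma weighted_dist_le_contracted x y : w (T x) (T y) <= L x y.
Proof. by rewrite /w /L !lerD2r ler_peMl// exprn_ege1. Qed.

Lemma contracted_le_M x y : L x y <= M x y.
Proof.
rewrite leNgt; apply/negP => lt_ML.
have [h h0 /(_ x y)] := meir_keeler (le_lt_trans (convex_M_ge0 x y) lt_ML).
by rewrite ltxx => contra; apply/notF/contra; lra.
Qed.

Lemma contracted_lt_M x y : 0 < M x y -> L x y < M x y.
Proof. by move=> M0; have [h h0 /(_ x y)] := meir_keeler M0; apply; lra. Qed.

(** At a fixed point [L z z] and [M z z] are both [2 * vphi z], which [L < M] forbids
    unless they vanish. *)
Lemma fixed_point_vphi_eq0 z : z = T z -> vphi z = 0.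
Proof.
move=> zT; have dz : d z z = 0 by apply/(brm_eq0 hd).
have wz : w z z = vphi z + vphi z by rewrite /w dz add0r.
have [->//|vz] := eqVneq (vphi z) 0.
have vz_gt0 : 0 < vphi z by rewrite lt_neqAle eq_sym vz vphi_ge0.
have Mz : M z z = vphi z + vphi z.
  by rewrite convex_ME -zT wz -!mulrDl mulrC mulKf ?gt_eqF.
have := contracted_lt_M (x := z) (y := z); rewrite Mz /L -zT dz mulr0; lra.
Qed.

Lemma fixed_point_unique z t : z = T z -> t = T t -> t = z.
Proof.
move=> zT tT; apply/(brm_eq0 hd).
have [z0 t0] := (fixed_point_vphi_eq0 zT, fixed_point_vphi_eq0 tT).
apply/eqP; rewrite eq_le d_ge0 andbT leNgt; apply/negP => d_gt0.
have dd x : d x x = 0 by apply/(brm_eq0 hd).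
have ME : M t z <= d t z.
  by apply: convex_M_le; rewrite /w -?zT -?tT ?z0 ?t0 ?dd ?addr0.
have le_dL : d t z <= L t z.
  by have := weighted_dist_le_contracted t z; rewrite /w -zT -tT z0 t0 !addr0.
have M_gt0 := lt_le_trans d_gt0 (le_trans le_dL (contracted_le_M _ _)).
by have := contracted_lt_M M_gt0; lra.
Qed.

(** * Orbits *)

Section Orbit.
Variable x0 : X.

Let x n := iter n T x0.
Let step n := w (x n) (x n.+1).

(** The next step also occurs in [M (x n) (x n.+1)], through the coefficient
    [c], so the comparison is by contradiction: if the step increased, that [M]
    would be at most the next step, which is at most [L], against [L < M]. *)
Lemma orbit_step_noninc n : step n.+1 <= step n.
Proof.
rewrite leNgt; apply/negP => lt_step.
have stepS_gt0 : 0 < step n.+1.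
  exact: le_lt_trans (weighted_dist_ge0 _ _) lt_step.
have le_L : step n.+1 <= L (x n) (x n.+1).
  exact: weighted_dist_le_contracted.
have le_M : M (x n) (x n.+1) <= step n.+1.
  by apply: convex_M_le; rewrite // ltW.
have := @contracted_lt_M (x n) (x n.+1); have := contracted_le_M (x n) (x n.+1).
lra.
Qed.

Lemma orbit_step_le m n : (m <= n)%N -> step n <= step m.
Proof.
move=> /subnKC <-; elim: (n - m)%N => [|k IH]; rewrite ?addn0// addnS.
exact: le_trans (orbit_step_noninc _) IH.
Qed.

(** Since steps do not increase, [M (x n) (x (n + k))] is bounded by the larger
    of the gap and the step at [n]; that maximum is the sequence which obeys
    the Meir-Keeler condition, the gap alone need not. *)
Lemma orbit_gap_cvg0 k : w (x n) (x (n + k)) @[n --> \oo] --> (0 : R).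
Proof.
pose u n := Num.max (w (x n) (x (n + k))) (step n).
have u_ge0 n : 0 <= u n by rewrite le_max weighted_dist_ge0.
have u0 : u n @[n --> \oo] --> (0 : R).
  apply: meir_keeler_seq_cvg0 => // e /meir_keeler[h h0 mk].
  exists h => // n; rewrite !gt_max => /andP[gap_lt step_lt].
  have lt_of y :
      w (x n) y < e + h -> w y (T y) <= step n -> w (x n.+1) (T y) < e.
    move=> xy yT.
    apply: le_lt_trans (weighted_dist_le_contracted _ _) (mk _ _ _).
    by apply: convex_M_lt => //; exact: le_lt_trans step_lt.
  apply/andP; split; last exact: lt_of (orbit_step_noninc _).
  by apply: lt_of gap_lt _; exact: (orbit_step_le (leq_addr _ _)).
apply/(cvg0_ge0P (fun=> weighted_dist_ge0 _ _)) => e.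
move=> /((cvg0_ge0P u_ge0).1 u0); apply: filterS => n.
by rewrite gt_max => /andP[].
Qed.

Lemma orbit_step_cvg0 : step n @[n --> \oo] --> (0 : R).
Proof.
suff -> : step = (fun n => w (x n) (x (n + 1)%N)) by exact: orbit_gap_cvg0.
by apply/funext => n; rewrite addn1.
Qed.

(** Steps that are positive are strictly decreasing, whereas equal points of
    the orbit have equal steps. *)
Lemma orbit_injective : (forall n, x n <> x n.+1) -> injective x.
Proof.
move=> x_neq.
have step_gt0 n : 0 < step n.
  rewrite lt_neqAle weighted_dist_ge0 andbT eq_sym; apply/eqP => step0.
  apply: (x_neq n); apply/(brm_eq0 hd)/eqP.
  by rewrite eq_le d_ge0 andbT -step0 /step /w -addrA lerDl addr_ge0.
have step_lt n : step n.+1 < step n.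
  have M_le : M (x n) (x n.+1) <= step n.
    by apply: convex_M_le => //; exact: orbit_step_noninc.
  apply: le_lt_trans (weighted_dist_le_contracted _ _) _.
  apply: lt_le_trans (contracted_lt_M _) M_le.
  apply: lt_le_trans (step_gt0 n.+1) _.
  exact: le_trans (weighted_dist_le_contracted _ _) (contracted_le_M _ _).
have neq m n : (m < n)%N -> x m <> x n.
  move=> lt_mn e.
  have eq_step : step m = step n by exact: (congr1 (fun y => w y (T y)) e).
  by have := orbit_step_le lt_mn; have := step_lt m; lra.
by move=> m n; case: (ltngtP m n) => // [/neq|/neq + /esym].
Qed.

Hypothesis x_inj : injective x.

(** The Meir-Keeler step turns the bound [e / 2 + h] on the gap [k] at [n] into
    [s ^+ 2 * d (x n.+1) (x (n + k.+1)) < e / 2]. The factor [s ^+ 2] absorbs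
    the factor [s] of the rectangular inequality, and the two outer edges of the
    path cost at most [2 * s * step n < h], which restores the bound for the
    gap [k + 2]. *)
Lemma orbit_gap_uniform e : 0 < e ->
  \forall n \near \oo, forall k, w (x n) (x (n + k)) < e.
Proof.
move=> e0; have s_gt0 : 0 < s by exact: lt_le_trans s_ge1.
have s2_gt0 : 0 < 2 * s by rewrite mulr_gt0.
have e2_gt0 : 0 < e / 2 by rewrite divr_gt0.
have [h0 h0_gt0 mk0] := meir_keeler e2_gt0.
pose h := Num.min h0 (e / 2).
have h_gt0 : 0 < h by rewrite lt_min h0_gt0.
have le_h_h0 : h <= h0 by rewrite ge_min lexx.
have le_h_e2 : h <= e / 2 by rewrite ge_min lexx orbT.
have mk y t : M y t < e / 2 + h -> L y t < e / 2 by move=> ?; apply: mk0; lra.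
have eh_gt0 : 0 < e / 2 + h by lra.
have gap_near k : \forall n \near \oo, w (x n) (x (n + k)) < e / 2 + h.
  apply: (cvg0_ge0P (fun=> weighted_dist_ge0 _ _)).1 (orbit_gap_cvg0 k) _ _.
  exact: eh_gt0.
near=> n.
have gap0 : w (x n) (x (n + 0)) < e / 2 + h by near: n; exact: gap_near.
have gap1 : w (x n) (x (n + 1)) < e / 2 + h by near: n; exact: gap_near.
have gap2 : w (x n) (x (n + 2)) < e / 2 + h by near: n; exact: gap_near.
have step_lt : 2 * s * step n < h.
  rewrite mulrC -ltr_pdivlMr//; near: n.
  by apply: (cvg0_ge0P (fun=> weighted_dist_ge0 _ _)).1 orbit_step_cvg0 _ _;
    rewrite divr_gt0.
have step_ge0 m : 0 <= step m by exact: weighted_dist_ge0.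
(* The path needs four distinct indices, hence a gap of at least one. *)
have gapSS k : w (x n) (x (n + k.+1)) < e / 2 + h ->
    w (x n) (x (n + k.+3)) < e / 2 + h.
  move=> gap_lt.
  have step_lt_h : step n < e / 2 + h.
    have le_s : step n <= s * step n by rewrite ler_peMl.
    by have := step_ge0 n; lra.
  have L_lt : L (x n) (x (n + k.+1)) < e / 2.
    apply/mk/convex_M_lt => //; apply: le_lt_trans step_lt_h.
    exact: (orbit_step_le (leq_addr _ _)).
  have mid_lt : s * d (x n.+1) (x (n + k.+2)) < e / 2.
    apply: le_lt_trans L_lt; rewrite addnS /L -addrA.
    rewrite -[leLHS]addr0 lerD ?addr_ge0// ler_wpM2r//.
    by rewrite expr2 ler_peMl ?(ltW s_gt0).
  have rect : d (x n) (x (n + k.+3)) <=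
      s * (d (x n) (x n.+1) + d (x n.+1) (x (n + k.+2))
           + d (x (n + k.+2)) (x (n + k.+3))).
    have neq i j : i != j -> x i <> x j by move=> /eqP ij /x_inj.
    by apply: (brm_rect hd); apply: neq; clear; lia.
  have s_step : s * step (n + k.+2) <= s * step n.
    by rewrite ler_wpM2l ?(ltW s_gt0)// orbit_step_le ?leq_addr.
  have le_s y : vphi y <= s * vphi y by rewrite ler_peMl.
  move: rect s_step step_lt (le_s (x n)) (le_s (x (n + k.+3))).
  have := vphi_ge0 (x n.+1); have := vphi_ge0 (x (n + k.+2)).
  move=> /(mulr_ge0 (ltW s_gt0)) + /(mulr_ge0 (ltW s_gt0)).
  have -> : step (n + k.+2) = w (x (n + k.+2)) (x (n + k.+3)).
    by rewrite (addnS n k.+2).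
  rewrite /step /w !mulrDr; lra.
move=> k; suff : w (x n) (x (n + k)) < e / 2 + h by lra.
have [-> //|k_gt0] := posnP k; rewrite -(prednK k_gt0).
have [] : w (x n) (x (n + k.-1.+1)) < e / 2 + h /\
    w (x n) (x (n + k.-1.+2)) < e / 2 + h; last by [].
by elim: k.-1 => [|j [IH1 IH2]]; split=> //; exact: gapSS.
Unshelve. all: by end_near. Qed.

Lemma orbit_cauchy : dcauchy d x.
Proof.
have d_le_w y z : d y z <= w y z by rewrite /w -addrA lerDl addr_ge0.
apply/cvgrPdist_lt => e /orbit_gap_uniform[N _ gap].
exists ([set n | (N <= n)%N], [set n | (N <= n)%N]).
  by split; exact: nbhs_infty_ge.
case=> m n [/= Nm Nn]; rewrite sub0r normrN ger0_norm//.
wlog lemn : m n Nm Nn / (m <= n)%N => [hw|].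
  by have [/hw->//|/ltnW/hw] := leqP m n; rewrite (brm_sym hd) => ->.
by apply: le_lt_trans (d_le_w _ _) _; rewrite -(subnKC lemn); exact: gap.
Qed.

Lemma orbit_vphi_cvg0 : vphi (x n) @[n --> \oo] --> (0 : R).
Proof.
apply/(cvg0_ge0P (fun=> vphi_ge0 _)) => e.
move=> /((cvg0_ge0P (fun=> weighted_dist_ge0 _ _)).1 orbit_step_cvg0).
apply: filterS => n; apply: le_lt_trans.
by rewrite /w addrAC lerDr addr_ge0.
Qed.

(** When [c] carries all the weight, [M (x n) z] tends to [w z (T z)] itself and
    [L <= M] gives nothing in the limit; averaging with [M z (x n)] leaves at
    most half of [w z (T z)] on the right. *)
Lemma orbit_limit_fixed z : dcvg d x z -> vphi z = 0 -> z = T z.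
Proof.
move=> xz z0; have [//|zT] := pselect (z = T z).
pose D := w z (T z).
(* Summing the two inequalities [L <= M] bounds [D] by this remainder. *)
pose r n := 2 * s ^+ 2 * (d (x n) z + step n)
            + 2 * (d (x n) z + vphi (x n)) + step n.
have r0 : r n @[n --> \oo] --> (0 : R).
  have -> : (0 : R) = 2 * s ^+ 2 * (0 + 0) + 2 * (0 + 0) + 0.
    by rewrite !addr0 !mulr0 addr0.
  apply: cvgD orbit_step_cvg0; apply: cvgD; apply: cvgM; do ?exact: cvg_cst.
    exact: cvgD xz orbit_step_cvg0.
  exact: cvgD xz orbit_vphi_cvg0.
have D_le : \forall n \near \oo, D <= r n.
  near=> n.
  have n_z : x n <> z by near: n; exact: injective_eventually_neq.
  have n_Tz : x n <> T z by near: n; exact: injective_eventually_neq.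
  have Sn_z : x n.+1 <> z.
    by near: n; apply: injective_eventually_neq => i j /x_inj[].
  have Sn_Tz : x n.+1 <> T z.
    by near: n; apply: injective_eventually_neq => i j /x_inj[].
  have rect : d z (T z) <=
      s * (d z (x n) + d (x n) (x n.+1) + d (x n.+1) (T z)).
    by apply: (brm_rect hd) => //; [move=> /x_inj/eqP; clear; lia|..].
  have s2_rect : d z (T z) <=
      s ^+ 2 * (d (x n) z + step n + d (x n.+1) (T z)).
    apply: le_trans rect _; apply: ler_pM; rewrite ?addr_ge0//.
    - exact: le_trans s_ge1.
    - by rewrite expr2 ler_peMl// (le_trans _ s_ge1).
    - by rewrite (brm_sym hd z) lerD2r lerD2l /step /w -addrA lerDl addr_ge0.
  pose A := d (x n) z + vphi (x n).
  have wxz : w (x n) z = A by rewrite /w z0 addr0.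
  have A_ge0 : 0 <= A by rewrite addr_ge0.
  have B_ge0 : 0 <= step n + D by rewrite addr_ge0// weighted_dist_ge0.
  have M_sum : M (x n) z + M z (x n) <= 2 * A + (step n + D).
    rewrite !convex_ME -mulrDl ler_pdivrMr// (weighted_dist_sym z (x n)) wxz.
    rewrite -[w z (T z)]/D -[w (x n) (T (x n))]/(step n).
    have := mulr_ge0 a_ge0 B_ge0; have := mulr_ge0 b_ge0 A_ge0.
    have := mulr_ge0 c_ge0 A_ge0.
    move: A (step n) D {wxz A_ge0 B_ge0} => A B D; lra.
  have L_sum : 2 * (s ^+ 2 * d (x n.+1) (T z) + vphi (T z)) <=
      L (x n) z + L z (x n).
    rewrite /L (brm_sym hd (T z)) -/(x n.+1).
    by have := vphi_ge0 (x n.+1); lra.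
  have DE : D = d z (T z) + vphi (T z) by rewrite /D /w z0 addr0.
  have := contracted_le_M (x n) z; have := contracted_le_M z (x n).
  move: M_sum L_sum s2_rect; rewrite /r -/A DE; lra.
have D_le0 : D <= 0 by exact: (cvgr_to_ge r0 D_le).
apply/(brm_eq0 hd)/eqP; rewrite eq_le d_ge0 andbT (le_trans _ D_le0)//.
by rewrite /D /w -addrA lerDl addr_ge0.
Unshelve. all: by end_near. Qed.

End Orbit.
End FixedPoint.

(** * The fixed point theorem *)

Unset Implicit Arguments.
Set Strict Implicit.

Theorem theorem3p14 (R : realType) (X : Type) (s : R) (d : X -> X -> R)
    (T : X -> X) (vphi : X -> R)
    (hd : brectangular_metric s d)
    (hcomplete : dcomplete d)
    (hvphi_ge0 : forall x : X, 0 <= vphi x)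
    (hvphi_lsc : seq_lower_semicontinuous d vphi)
    (hT : convex_C_class_weakly_contractive s d T vphi) :
  exists z : X, [/\ z = T z, (forall w : X, w = T w -> w = z) & vphi z = 0].
Proof.
have [a [b [c [psi [phi [F]]]]]] := hT.
move=> [[a0 b0 c0 abc0] [hpsi hphi hF] _ contraction].
have mk e : 0 < e -> exists2 h, 0 < h & forall x y,
    convex_M a b c d T vphi x y < e + h ->
    @contracted_dist R X s d T vphi x y < e.
  move=> /(C_class_meir_keeler hpsi hphi hF)[h h0 mk].
  exists h => // x y M_lt; apply: mk (contraction x y) => //.
  exact: (convex_M_ge0 hd hvphi_ge0).
suff [z zT] : exists z, z = T z.
  exists z; split => //.
    by move=> t tT; exact: (fixed_point_unique hd hvphi_ge0 a0 b0 c0 abc0 mk).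
  exact: (fixed_point_vphi_eq0 hd hvphi_ge0 abc0 mk zT).
have [x0] := brm_inhabited hd.
have [[n xn]|nofix] := pselect (exists n, iter n T x0 = T (iter n T x0)).
  by exists (iter n T x0).
have x_inj : injective (fun n => iter n T x0).
  apply: (orbit_injective hd hvphi_ge0 a0 b0 c0 abc0 mk) => n xn.
  by apply: nofix; exists n.
have [z xz] := hcomplete _ (orbit_cauchy hd hvphi_ge0 a0 b0 c0 abc0 mk x_inj).
exists z; apply: (orbit_limit_fixed hd hvphi_ge0 a0 b0 c0 abc0 mk x_inj xz).
have vphi_cvg := orbit_vphi_cvg0 hd hvphi_ge0 a0 b0 c0 abc0 mk x0.
have /cvg_limn_einf_sup[liminf0 _] :
    (vphi (iter n T x0))%:E @[n --> \oo] --> 0%:E.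
  by apply: cvg_EFin vphi_cvg; exact: nearW.
have := hvphi_lsc z _ xz; rewrite liminf0 lee_fin => vz_le0.
by apply/eqP; rewrite eq_le vz_le0 hvphi_ge0.
Qed.
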